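(* Let $R$ be a commutative ring with identity, $I$ an ideal of $R$, $M$ an $R$-module and $N$ a submodule of $M$. Then $I(+)N$ is a quasi $J$-ideal of $R(+)M$ if and only if $I$ is a quasi $J$-ideal of $R$.
   Context: All rings are commutative with identity and all modules are unital. The idealization ring of $M$ is $R(+)M=\{(r,m): r\in R,\ m\in M\}$ with coordinatewise addition and multiplication $(r_1,m_1)(r_2,m_2)=(r_1r_2,\ r_1m_2+r_2m_1)$. For an ideal $I$ of $R$ and a submodule $N$ of $M$, $I(+)N=\{(r,m): r\in I,\ m\in N\}$; it is an ideal of $R(+)M$ if and only if $IM\subseteq N$. $J(A)$ is the Jacobson radical of a ring $A$. A proper ideal $I$ of a ring $A$ is a $J$-ideal if whenever $a,b\in A$ with $ab\in I$ and $a\notin J(A)$, then $b\in I$. A proper ideal $I$ of $A$ is a quasi $J$-ideal if its radical $\sqrt I=\{x\in A: x^n\in I \text{ for some positive integer } n\}$ is a $J$-ideal.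
   Formalization: The formal theorem adds the hypothesis IM ⊆ N, i.e. that I(+)N is an ideal of R(+)M; without it the equivalence fails, e.g. R local and not a field, I its maximal ideal, M = R, N = 0. *)

(* Defs.v *)
From HB Require Import structures.
From mathcomp Require Import all_boot all_order all_algebra.
From mathcomp Require Import boolp classical_sets.

Set Implicit Arguments.
Unset Strict Implicit.
Unset Printing Implicit Defensive.

Import GRing.Theory.

Local Open Scope classical_set_scope.
Local Open Scope ring_scope.

(* Rings are [comPzRingType]: the zero ring is allowed.  Subsets are
   [Prop]-valued, so ideals need not be decidable. *)

Section Ideals.
Variable A : comPzRingType.
Implicit Types I J : set A.

(* The ideals of A are the submodules of the regular module A^o; they are not
   required to be proper, unlike those of [ring_quotient]. *)
Definition is_ideal I : Prop := @GRing.submod_closed A A^o [in I].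

Definition is_proper_ideal I : Prop := is_ideal I /\ I <> [set: A].

Definition is_maximal_ideal I : Prop :=
  is_proper_ideal I /\ forall J, is_proper_ideal J -> I `<=` J -> J = I.

(* The intersection is all of A when A is the zero ring. *)
Definition jacobson_radical : set A := \bigcap_(I in is_maximal_ideal) I.

Definition radical I : set A := [set x | exists2 n, (0 < n)%N & I (x ^+ n)].

Definition J_ideal I : Prop :=
  is_proper_ideal I /\
  forall a b, I (a * b) -> ~ jacobson_radical a -> I b.

Definition quasi_J_ideal I : Prop := is_proper_ideal I /\ J_ideal (radical I).

End Ideals.

Arguments jacobson_radical : clear implicits.

Definition is_submodule (R : pzRingType) (M : lmodType R) (N : set M) : Prop :=
  GRing.submod_closed [in N].

(* The submodule I M: finite sums of products r *: m with r in I. *)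
Definition ideal_smul (R : pzRingType) (M : lmodType R) (I : set R) : set M :=
  [set x | exists n (r : 'I_n -> R) (m : 'I_n -> M),
     (forall i, I (r i)) /\ x = \sum_(i < n) r i *: m i].

Arguments ideal_smul {R} M I.

(* A type alias, to keep this product apart from the componentwise one that
   [R * M] may carry. *)
Definition idealization (R : comPzRingType) (M : lmodType R) : Type :=
  (R * M)%type.

Arguments idealization : clear implicits.

Section IdealizationRing.
Variables (R : comPzRingType) (M : lmodType R).

HB.instance Definition _ :=
  GRing.Zmodule.copy (idealization R M) (R * M)%type.

Definition idealization_one : idealization R M := (1, 0).

Definition idealization_mul (x y : idealization R M) : idealization R M :=
  (x.1 * y.1, x.1 *: y.2 + y.1 *: x.2).

Fact idealization_mulA : associative idealization_mul.
Proof.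
move=> [a u] [b v] [c w]; rewrite /idealization_mul /=.
by rewrite mulrA !scalerDr !scalerA addrA [c * a]mulrC [c * b]mulrC.
Qed.

Fact idealization_mulC : commutative idealization_mul.
Proof.
by move=> [a u] [b v]; rewrite /idealization_mul /= mulrC addrC.
Qed.

Fact idealization_mul1 : left_id idealization_one idealization_mul.
Proof.
by move=> [a u]; rewrite /idealization_mul /= mul1r scale1r scaler0 addr0.
Qed.

Fact idealization_mulDl : left_distributive idealization_mul +%R.
Proof.
move=> [a u] [b v] [c w]; rewrite /idealization_mul /=.
congr pair; first exact: mulrDl.
by rewrite /= scalerDl scalerDr addrACA.
Qed.

HB.instance Definition _ :=
  GRing.Zmodule_isComPzRing.Build (idealization R M)
    idealization_mulA idealization_mulC idealization_mul1 idealization_mulDl.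

Definition idealization_set (I : set R) (N : set M) :
  set (idealization R M) := I `*` N.

End IdealizationRing.

(* Main.v *)
(* Projecting along the nilpotent ideal 0(+)M is compatible with everything in
   the definition.  A proper ideal of R(+)M has a proper image in R, because
   (1,m) is a unit with inverse (1,-m); hence the maximal ideals of R(+)M are
   the P(+)M with P maximal, and J(R(+)M) = J(R)(+)M.  Moreover
   (r,m)^(n+1) = (r^(n+1), (n+1) r^n m), so that the radical of I(+)N is
   sqrt(I)(+)M as soon as IM is contained in N. *)
Require Import Defs.
From mathcomp Require Import all_boot all_order all_algebra.
From mathcomp Require Import boolp classical_sets.
Local Open Scope classical_set_scope.
Local Open Scope ring_scope.

Import GRing.Theory.

Lemma is_submoduleP (R : pzRingType) (M : lmodType R) (N : set M) :
  is_submodule N <->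
  N 0 /\ forall (a : R) (x y : M), N x -> N y -> N (a *: x + y).
Proof.
split=> [[N0 ND]|[N0 ND]].
  split=> [|a x y Nx Ny]; first by move/set_mem: N0.
  by apply: set_mem; apply: ND; apply: mem_set.
split=> [|a x y /set_mem Nx /set_mem Ny]; first exact: mem_set.
by apply: mem_set; apply: ND.
Qed.

Lemma is_idealP (A : comPzRingType) (I : set A) :
  is_ideal I <-> I 0 /\ forall a x y, I x -> I y -> I (a * x + y).
Proof. exact: (@is_submoduleP A A^o I). Qed.

Lemma ideal_mull (A : comPzRingType) (I : set A) (a x : A) :
  is_ideal I -> I x -> I (a * x).
Proof. by move=> /is_idealP[I0 ID] Ix; rewrite -[a * x]addr0; apply: ID. Qed.

Lemma proper_idealP (A : comPzRingType) (I : set A) :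
  is_proper_ideal I <-> is_ideal I /\ ~ I 1.
Proof.
split=> -[idI nI]; split=> // I1; apply: nI; last by rewrite I1.
by apply/seteqP; split=> // x _; rewrite -[x]mulr1; apply: ideal_mull.
Qed.

Lemma ideal_smul_mem (R : pzRingType) (M : lmodType R) (I : set R) (r : R)
    (m : M) : I r -> ideal_smul M I (r *: m).
Proof.
move=> Ir; exists 1, (fun=> r), (fun=> m); split=> //.
by rewrite big_ord1.
Qed.

Section Idealization.
Variables (R : comPzRingType) (M : lmodType R).
Implicit Types (I P : set R) (N : set M) (K : set (idealization R M)).

Lemma idealization_ideal I N :
  is_ideal I -> is_submodule N -> ideal_smul M I `<=` N ->
  is_ideal (idealization_set I N).
Proof.
move=> /is_idealP[I0 ID] /is_submoduleP[N0 ND] IMN; apply/is_idealP.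
split=> [|[a u] [r m] [s n] [/= Ir Nm] [/= Is Nn]]; first by [].
split=> /=.
  exact: ID.
(* The second coordinate is [a *: m + r *: u + n]; its middle term lies in IM, hence in [N]. *)
rewrite -addrA; apply: (ND) => //.
rewrite -[r *: u]scale1r; apply: ND => //.
exact/IMN/ideal_smul_mem.
Qed.

Lemma idealization_proper I N :
  is_ideal I -> is_submodule N -> ideal_smul M I `<=` N ->
  is_proper_ideal (idealization_set I N) <-> is_proper_ideal I.
Proof.
move=> idI sN IMN; split=> /proper_idealP[_ nI]; apply/proper_idealP; split=> //.
- by move=> I1; apply: nI; split=> //=; case/is_submoduleP: sN.
- exact: idealization_ideal.
- by case.
Qed.

Lemma fst_ideal K : is_ideal K -> is_ideal (fst @` K).
Proof.
move=> /is_idealP[K0 KD]; apply/is_idealP; split; first by exists 0.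
move=> a _ _ [x Kx <-] [y Ky <-].
by exists (((a, 0) : idealization R M) * x + y); first exact: KD.
Qed.

Lemma fst_proper_ideal K : is_proper_ideal K -> is_proper_ideal (fst @` K).
Proof.
move=> /proper_idealP[idK nK]; apply/proper_idealP; split.
  exact: fst_ideal.
case=> -[r m] Krm /= r1; apply: nK; rewrite r1 in Krm.
suff -> : (1 : idealization R M) =
          ((1, - m) : idealization R M) * ((1, m) : idealization R M).
  exact: ideal_mull.
by congr pair; rewrite /= ?mulr1 // !scale1r subrr.
Qed.

Lemma fst_idealization_set P : fst @` idealization_set P [set: M] = P.
Proof.
apply/seteqP; split=> [_ [x [Px _] <-] //|r Pr].
by exists (r, 0).
Qed.

Lemma sub_idealization_fst K : K `<=` idealization_set (fst @` K) [set: M].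
Proof. by move=> x Kx; split=> //; exists x. Qed.

(** Here [P] is an arbitrary subset: it inherits being an ideal from P(+)M as the image under
    [fst]. *)
Lemma idealization_properT P :
  is_proper_ideal (idealization_set P [set: M]) <-> is_proper_ideal P.
Proof.
split=> pP.
  by rewrite -[P]fst_idealization_set; apply: fst_proper_ideal.
have [idP _] := pP.
by apply/idealization_proper=> //; apply/is_submoduleP.
Qed.

(** A proper [K] containing P(+)M projects onto a proper ideal containing [P], hence onto [P]
    itself, which forces [K] into P(+)M. *)
Lemma idealization_maximal P :
  is_maximal_ideal P -> is_maximal_ideal (idealization_set P [set: M]).
Proof.
move=> [pP maxP]; split=> [|K pK PK]; first exact/idealization_properT.
apply/seteqP; split=> //.
rewrite -(maxP (fst @` K)); first exact: sub_idealization_fst.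
  exact: fst_proper_ideal.
by rewrite -[P]fst_idealization_set; apply: image_subset.
Qed.

(** [K] lies in the product of its projection with [M], which is still proper, so maximality makes
    them equal. *)
Lemma maximal_idealization K :
  is_maximal_ideal K -> K = idealization_set (fst @` K) [set: M].
Proof.
move=> [pK maxK]; apply/esym/maxK; last exact: sub_idealization_fst.
exact/idealization_properT/fst_proper_ideal.
Qed.

(** A proper [Q] above the projection lifts to a proper Q(+)M above [K]; maximality identifies the
    two, and projecting back gives [Q]. *)
Lemma fst_maximal K : is_maximal_ideal K -> is_maximal_ideal (fst @` K).
Proof.
move=> mK; have [pK maxK] := mK; split=> [|Q pQ KQ].
  exact: fst_proper_ideal.
rewrite -[Q]fst_idealization_set; congr image.
apply: maxK; first exact/idealization_properT.
by move=> x Kx; split=> //; apply: KQ; exists x.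
Qed.

Lemma jacobson_radical_idealization :
  jacobson_radical (idealization R M) =
  idealization_set (jacobson_radical R) [set: M].
Proof.
apply/seteqP; split=> [x Jx|x [Jx _] K mK].
  by split=> // P mP; case: (Jx _ (idealization_maximal _ mP)).
by rewrite (maximal_idealization _ mK); split=> //; apply: Jx; apply: fst_maximal.
Qed.

(** This is the derivative rule of a square-zero extension; the successor exponent avoids a
    truncated predecessor. *)
Lemma idealization_expr (r : R) (m : M) n :
  ((r, m) : idealization R M) ^+ n.+1 =
  (r ^+ n.+1, n.+1%:R *: (r ^+ n *: m)).
Proof.
elim: n => [|n IHn]; first by rewrite !expr1 expr0 !scale1r.
rewrite exprS IHn; congr pair; rewrite /= -?exprS //.
rewrite !scalerA [r * _]mulrC -mulrA -exprS -scalerDl.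
by rewrite [in RHS]mulrSr mulrDl mul1r.
Qed.

Lemma radical_idealization I N :
  is_ideal I -> is_submodule N -> ideal_smul M I `<=` N ->
  radical (idealization_set I N) = idealization_set (radical I) [set: M].
Proof.
move=> idI /is_submoduleP[N0 ND] IMN.
apply/seteqP; split=> -[r m].
  case=> -[//|n] _; rewrite idealization_expr => -[Irn _].
  by split=> //; exists n.+1.
(* One more power is taken than for [r]: the second coordinate is then a multiple of [r ^+ n *: m],
   which lies in IM and so in [N]. *)
case=> -[n n0 Irn] _; exists n.+1 => //.
rewrite idealization_expr; split=> /=; first by rewrite exprS; apply: ideal_mull.
by rewrite -[_ *: _]addr0; apply: ND => //; apply/IMN/ideal_smul_mem.
Qed.

(** Membership in P(+)M and in the Jacobson radical both depend on first coordinates only, and these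
    multiply as in [R]. *)
Lemma idealization_J_ideal P :
  J_ideal (idealization_set P [set: M]) <-> J_ideal P.
Proof.
rewrite /J_ideal jacobson_radical_idealization.
split=> -[pP JP]; (split; first exact/idealization_properT).
- move=> a b Pab nJa.
  suff [] : idealization_set P [set: M] (b, 0) by [].
  by apply: (JP (a, 0)) => // -[].
- move=> [a m] [b n] [/= Pab _] nJa; split=> //.
  by apply: (JP a) => // Ja; apply: nJa.
Qed.

End Idealization.

Theorem theorem6 (R : comPzRingType) (I : set R) (M : lmodType R) (N : set M)
    (idealI : is_ideal I) (submodN : is_submodule N)
    (subIMN : ideal_smul M I `<=` N) :
  quasi_J_ideal (idealization_set I N) <-> quasi_J_ideal I.
Proof.
rewrite /quasi_J_ideal radical_idealization //.
by rewrite idealization_J_ideal idealization_proper.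
Qed.
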